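(* Let $\Psi=(\Psi_1,\Psi_2)$ be a Clifford conservative vectorial FQ operation which is Clifford productive, i.e. $\Psi_1^2=\Psi_2^2=-1$ and $\Psi_1\Psi_2+\Psi_2\Psi_1=0$ as formal series. Then $$\Psi(A_1,A_2)=\cdots(1+U^{\langle3\rangle})(1+U^{\langle2\rangle})(1+U^{\langle1\rangle})\,(Q_1,Q_2)\,(1+U^{\langle1\rangle})^{-1}(1+U^{\langle2\rangle})^{-1}(1+U^{\langle3\rangle})^{-1}\cdots$$ (conjugation applied componentwise, the infinite products converging formally) for some scalar FQ operations $U^{\langle i\rangle}$ homogeneous of degree $i$ ($i\ge1$). Moreover, the $U^{\langle i\rangle}$ can be chosen to satisfy $((U^{\langle i\rangle})^0_{Q_1})^0_{Q_2}=0$, and with this requirement they are uniquely determined by $\Psi$. Conversely, any such sequence $U^{\langle i\rangle}$ yields by this formula a Clifford conservative, Clifford productive vectorial FQ operation.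
   Context: Setting. $(Q_1,Q_2)$ is a Clifford system: $Q_1^2=Q_2^2=-1$, $Q_1Q_2=-Q_2Q_1$. $R_1,R_2$ are formal noncommuting infinitesimal variables; one works in the real algebra generated by $Q_1,Q_2,R_1,R_2$ (free apart from the Clifford relations), completed with respect to total degree in $R_1,R_2$. Put $A_i=Q_i+R_i$. For $Q$ with $Q^2=-1$ and any $X$ put $X^0_Q=\frac12(X+Q^{-1}XQ)$, $X^1_Q=\frac12(X-Q^{-1}XQ)$. The split variables are $r_1,\dots,r_8$: for $j\in\{1,2\}$, $\iota_1,\iota_2\in\{0,1\}$, $r_{4(j-1)+2\iota_1+\iota_2+1}=((R_jQ_j^{-1})^{\iota_1}_{Q_1})^{\iota_2}_{Q_2}$ (so $r_k$ commutes with $Q_m$ if $\iota_m=0$, anticommutes if $\iota_m=1$). A scalar FQ operation around $(Q_1,Q_2)$ is an element $f_0(r_1,\dots,r_8)$ with $f_0$ a formal real noncommutative power series; it is homogeneous of degree $i$ if $f_0$ is. A vectorial FQ operation is $\Psi(A_1,A_2)=(f_1(r)Q_1,f_2(r)Q_2)$ with $f_1,f_2$ such series; it is Clifford conservative if both constant terms equal $1$. *)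

(* Defs.v *)
From HB Require Import structures.
From mathcomp Require Import all_boot all_order all_algebra.
Set Implicit Arguments. Unset Strict Implicit. Unset Printing Implicit Defensive.
Import Order.TTheory GRing.Theory Num.Theory.
Local Open Scope ring_scope.

(* The completed algebra generated by Q1,Q2 (Clifford: Q1^2=Q2^2=-1,        *)
(* Q1Q2=-Q2Q1) and free noncommuting R1,R2, completed w.r.t. R-degree.      *)
(* It is the (completed) free product  Cl * T(R1,R2), whose standard basis   *)
(* consists of the normal words                                              *)
(*      e(c0) R_{j1} e(c1) R_{j2} ... R_{jn} e(cn)                           *)
(* where e(a,b) = Q1^a Q2^b (a,b in {0,1}) is the Clifford basis.            *)
(* Every degree-n piece is finite dimensional, so the completion is exactly  *)
(* the space of ALL functions  word -> R  (coefficient of each basis word).  *)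

(* Clifford basis index: (a,b) stands for Q1^a Q2^b. *)
Definition cl := (bool * bool)%type.

(* index of the product basis element: e(a) e(b) = sgn a b * e(clx a b) *)
Definition clx (a b : cl) : cl := (addb a.1 b.1, addb a.2 b.2).

Section Alg.
Variable R : fieldType.

(* Q1^a1 Q2^a2 Q1^b1 Q2^b2 = (-1)^(a2 b1 + a1 b1 + a2 b2) Q1^(a1+b1) Q2^(a2+b2) *)
Definition sgn (a b : cl) : R :=
  (-1) ^+ (nat_of_bool (a.2 && b.1) + nat_of_bool (a.1 && b.1)
           + nat_of_bool (a.2 && b.2))%N.

End Alg.

(* Normal words:  WEnd c = e(c);  WCons c j w = e(c) R_j w,
   where j = false means R1 and j = true means R2. *)
Inductive word : Type :=
| WEnd of cl
| WCons of cl & bool & word.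

Fixpoint deg (w : word) : nat :=
  match w with WEnd _ => 0%N | WCons _ _ w' => (deg w').+1 end.

Section Alg2.
Variable R : fieldType.

Definition alg := word -> R.

Definition azero : alg := fun _ => 0.
Definition aadd (x y : alg) : alg := fun w => x w + y w.
Definition aopp (x : alg) : alg := fun w => - x w.
Definition ascale (r : R) (x : alg) : alg := fun w => r * x w.

(* multiplication: sum over all ways of splitting a normal word, the
   Clifford letter at the cut being written as a product e(a) e(clx a c). *)
Fixpoint amul (x y : alg) (w : word) {struct w} : R :=
  match w with
  | WEnd c =>
      \sum_(a : cl) sgn R a (clx a c) * x (WEnd a) * y (WEnd (clx a c))
  | WCons c j w' =>
      \sum_(a : cl) sgn R a (clx a c) * x (WEnd a) * y (WCons (clx a c) j w')
      + amul (fun u => x (WCons c j u)) y w'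
  end.

Definition clA (c : cl) : alg :=
  fun w => match w with WEnd c' => if c' == c then 1 else 0 | _ => 0 end.

Definition aone : alg := clA (false, false).
Definition Q1 : alg := clA (true, false).
Definition Q2 : alg := clA (false, true).
Definition Qgen (j : bool) : alg := if j then Q2 else Q1.

Definition Rgen (j : bool) : alg :=
  fun w => match w with
           | WCons c j' (WEnd c') =>
               if (c == (false, false)) && (j' == j) && (c' == (false, false))
               then 1 else 0
           | _ => 0
           end.

(* Q^{-1} for Q in {Q1,Q2}: since Q^2 = -1, Q^{-1} = -Q. *)
Definition invQ (Q : alg) : alg := aopp Q.

Definition part0 (Q X : alg) : alg :=
  ascale (2%:R^-1) (aadd X (amul (amul (invQ Q) X) Q)).
Definition part1 (Q X : alg) : alg :=
  ascale (2%:R^-1) (aadd X (aopp (amul (amul (invQ Q) X) Q))).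
Definition partb (b : bool) (Q X : alg) : alg :=
  if b then part1 Q X else part0 Q X.

(* split variables r_1..r_8, indexed by k : 'I_8 (k = index - 1):
   k = 4(j-1) + 2 iota1 + iota2, so  j-1 = k / 4,  iota1 = odd (k/2),
   iota2 = odd k;   r = ((R_j Q_j^{-1})^{iota1}_{Q1})^{iota2}_{Q2}. *)
Definition rvar (k : 'I_8) : alg :=
  let j := (3 < k)%N in
  let i1 := odd (k %/ 2) in
  let i2 := odd k in
  partb i2 Q2 (partb i1 Q1 (amul (Rgen j) (invQ (Qgen j)))).

Definition aprod (s : seq alg) : alg := foldr amul aone s.
Definition apow (x : alg) (m : nat) : alg := aprod (nseq m x).

(* A formal noncommutative power series in r_1..r_8 is its coefficient
   function on noncommutative monomials (sequences of variable indices).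
   Substitution of the r's: formally convergent sum; since every r_k has
   zero degree-0 part, monomials of length > deg w do not contribute at w. *)
Definition series := seq 'I_8 -> R.

Definition evalFQ (f : series) : alg :=
  fun w => \sum_(m < (deg w).+1) \sum_(t : m.-tuple 'I_8)
             f (tval t) * aprod (map rvar (tval t)) w.

Definition homog (i : nat) (f : series) : Prop :=
  forall t : seq 'I_8, size t <> i -> f t = 0.

Definition scalarFQ_hom (i : nat) (U : alg) : Prop :=
  exists f : series, homog i f /\ U = evalFQ f.

Definition Psi1 (f1 : series) : alg := amul (evalFQ f1) Q1.
Definition Psi2 (f2 : series) : alg := amul (evalFQ f2) Q2.

Definition clifford_conservative (f1 f2 : series) : Prop :=
  f1 [::] = 1 /\ f2 [::] = 1.

Definition clifford_productive (P1 P2 : alg) : Prop :=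
  amul P1 P1 = aopp aone /\ amul P2 P2 = aopp aone /\
  aadd (amul P1 P2) (amul P2 P1) = azero.

(* (1+u)^{-1} = sum_m (-u)^m, formally convergent when u has no
   degree-0 part (terms with m > deg w vanish at w). *)
Definition inv1p (u : alg) : alg :=
  fun w => \sum_(m < (deg w).+1) apow (aopp u) m w.

Fixpoint Pn (U : nat -> alg) (N : nat) : alg :=
  match N with
  | 0 => aone
  | N'.+1 => amul (aadd aone (U N)) (Pn U N')
  end.
Fixpoint Pinvn (U : nat -> alg) (N : nat) : alg :=
  match N with
  | 0 => aone
  | N'.+1 => amul (Pinvn U N') (inv1p (U N))
  end.

Definition flim (s : nat -> alg) (x : alg) : Prop :=
  forall w, exists N0, forall N, (N0 <= N)%N -> s N w = x w.

Definition conj_repr (U : nat -> alg) (P1 P2 : alg) : Prop :=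
  flim (fun N => amul (amul (Pn U N) Q1) (Pinvn U N)) P1 /\
  flim (fun N => amul (amul (Pn U N) Q2) (Pinvn U N)) P2.

Definition admissible (U : nat -> alg) : Prop :=
  forall i, (1 <= i)%N -> scalarFQ_hom i (U i).

Definition normalized (U : nat -> alg) : Prop :=
  forall i, (1 <= i)%N -> part0 Q2 (part0 Q1 (U i)) = azero.

End Alg2.

(* Main.v *)
Require Import Defs.
From HB Require Import structures.
From mathcomp Require Import all_boot all_order all_algebra.
From mathcomp Require Import boolp.
From mathcomp Require Import ring lra.
Set Implicit Arguments.
Unset Strict Implicit.
Unset Printing Implicit Defensive.
Import Order.TTheory GRing.Theory Num.Theory.
Local Open Scope ring_scope.

(* Write [F] for the scalar FQ operations; [F] is closed under products,
   formal limits and conjugation by [Q_1], [Q_2], since each split variable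
   commutes or anticommutes with each [Q_j]. Suppose that conjugating
   [(Q_1, Q_2)] by the first [n-1] factors gives [X] with [X = Psi] below
   degree [n], and let [g_j Q_j] be the degree [n] part of [Psi_j - X_j].
   A further factor [1 + U], with [U] of degree [n], changes the degree [n]
   part of [X_j] by [U Q_j - Q_j U], so one needs [U - Q_j U Q_j^-1 = g_j] for
   both [j]. Comparing the Clifford relations of [Psi] and of [X] in degree [n]
   shows that [g_j] anticommutes with [Q_j] and that
   [g_1 - Q_2 g_1 Q_2^-1 = g_2 - Q_1 g_2 Q_1^-1]; these are exactly the
   conditions under which [U = (g_1 + (g_2)^0_{Q_1}) / 2] is a solution. Two
   solutions differ by an element commuting with [Q_1] and [Q_2], whence the
   uniqueness under the normalization. *)

(** * Ring laws for the product of coefficient functions on normal words *)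

Section AlgebraLaws.
Variable R : fieldType.
Implicit Types (x y z : alg R) (w : word).

Lemma sum_cl (F : cl -> R) :
  \sum_(a : cl) F a
  = F (true, true) + F (true, false) + F (false, true) + F (false, false).
Proof.
transitivity (\sum_(a : bool) \sum_(b : bool) F (a, b)).
  by rewrite pair_big; apply: eq_bigr => -[].
by rewrite !big_bool /= addrA.
Qed.

Lemma amulDl w x y z : amul (aadd x y) z w = amul x z w + amul y z w.
Proof.
(* [x] and [y] stay general because the recursion of [amul] replaces its left argument by a slice,
   the coefficients after a fixed first letter. *)
elim: w x y => [c|c j w IH] x y /=.
  by rewrite -big_split; apply: eq_bigr => a _; rewrite /aadd /=; ring.
rewrite -[X in amul X]/(aadd (fun u => x (WCons c j u)) (fun u => y (WCons c j u))).
rewrite IH addrACA; congr (_ + _).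
by rewrite -big_split; apply: eq_bigr => a _; rewrite /aadd /=; ring.
Qed.

Lemma amulDr w x y z : amul x (aadd y z) w = amul x y w + amul x z w.
Proof.
elim: w x => [c|c j w IH] x /=.
  by rewrite -big_split; apply: eq_bigr => a _; rewrite /aadd /=; ring.
rewrite IH addrACA; congr (_ + _).
by rewrite -big_split; apply: eq_bigr => a _; rewrite /aadd /=; ring.
Qed.

Lemma amulZl w k x y : amul (ascale k x) y w = k * amul x y w.
Proof.
elim: w x => [c|c j w IH] x /=.
  by rewrite big_distrr; apply: eq_bigr => a _; rewrite /ascale /=; ring.
rewrite -[X in amul X]/(ascale k (fun u => x (WCons c j u))) IH mulrDr.
congr (_ + _).
by rewrite big_distrr; apply: eq_bigr => a _; rewrite /ascale /=; ring.
Qed.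

Lemma amulZr w k x y : amul x (ascale k y) w = k * amul x y w.
Proof.
elim: w x => [c|c j w IH] x /=.
  by rewrite big_distrr; apply: eq_bigr => a _; rewrite /ascale /=; ring.
rewrite IH mulrDr; congr (_ + _).
by rewrite big_distrr; apply: eq_bigr => a _; rewrite /ascale /=; ring.
Qed.

Lemma amul0l w y : amul (azero R) y w = 0.
Proof.
elim: w => [c|c j w IH] /=; last rewrite -/(azero R) IH addr0.
all: by apply: big1 => a _; rewrite /azero mulr0 mul0r.
Qed.

(** Induction on the word: slicing [amul x y] along its first letter gives a combination of slices
    of [y] plus a product with a slice of [x]. Bilinearity and induction then leave only the cocycle
    identity of [sgn], checked for each [c]. *)
Lemma amulA w x y z : amul x (amul y z) w = amul (amul x y) z w.
Proof.
elim: w x y => [c|c j w IH] x y.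
  rewrite /= !sum_cl.
  case: c => [[] []]; rewrite /sgn /clx /=; ring.
rewrite /=.
set f := (X in _ = _ + amul X z w).
(* [F a] collects the words whose cut falls before the first letter, with Clifford part [a] taken
   from [x]. *)
pose F a := ascale (sgn R a (clx a c) * x (WEnd a))
  (fun u => y (WCons (clx a c) j u)).
have -> : f = aadd (aadd (aadd (F (true, true)) (F (true, false)))
                         (aadd (F (false, true)) (F (false, false))))
                   (amul (fun u => x (WCons c j u)) y).
  by apply/funext => u; rewrite /f sum_cl /F /aadd /ascale /=; ring.
rewrite !amulDl !amulZl IH {f F}.
rewrite !sum_cl.
case: c => [[] []]; rewrite /sgn /clx /=; ring.
Qed.

Lemma amul1l w y : amul (aone R) y w = y w.
Proof.
case: w => [c|c j w] /=; last rewrite -/(azero R) amul0l.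
all: rewrite sum_cl /clx /sgn /=; case: c => [[] []] /=; ring.
Qed.

Lemma amul1r w x : amul x (aone R) w = x w.
Proof.
elim: w x => [c|c j w IH] x /=; first last.
  by rewrite IH big1 ?add0r // => a _; rewrite mulr0.
rewrite sum_cl /clx /sgn /=; case: c => [[] []] /=; ring.
Qed.

End AlgebraLaws.

(** Elements are functions on an infinite set of words, so equality and choice on them are
    classical. *)
HB.instance Definition _ (R : fieldType) := gen_eqMixin (alg R).
HB.instance Definition _ (R : fieldType) := gen_choiceMixin (alg R).

(** * The completed algebra as a unital associative algebra over the base field *)

Section Instances.
Variable R : fieldType.

Fact aaddA : associative (@aadd R).
Proof. by move=> x y z; apply/funext => w; rewrite /aadd addrA. Qed.
Fact aaddC : commutative (@aadd R).
Proof. by move=> x y; apply/funext => w; rewrite /aadd addrC. Qed.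
Fact aadd0 : left_id (azero R) (@aadd R).
Proof. by move=> x; apply/funext => w; rewrite /aadd add0r. Qed.
Fact aaddN : left_inverse (azero R) (@aopp R) (@aadd R).
Proof. by move=> x; apply/funext => w; rewrite /aadd /aopp addNr. Qed.

HB.instance Definition _ := GRing.isZmodule.Build (alg R) aaddA aaddC aadd0 aaddN.

Fact alg_mulA : associative (@amul R).
Proof. by move=> x y z; apply/funext => w; exact: amulA. Qed.
Fact alg_mul1l : left_id (aone R) (@amul R).
Proof. by move=> x; apply/funext => w; exact: amul1l. Qed.
Fact alg_mul1r : right_id (aone R) (@amul R).
Proof. by move=> x; apply/funext => w; exact: amul1r. Qed.
Fact alg_mulDl : left_distributive (@amul R) +%R.
Proof. by move=> x y z; apply/funext => w; exact: amulDl. Qed.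
Fact alg_mulDr : right_distributive (@amul R) +%R.
Proof. by move=> x y z; apply/funext => w; exact: amulDr. Qed.

Fact alg_one_neq0 : aone R != azero R.
Proof.
apply/eqP => /(congr1 (fun x : alg R => x (WEnd (false, false)))) /eqP.
by rewrite oner_eq0.
Qed.

HB.instance Definition _ := GRing.Zmodule_isNzRing.Build (alg R)
  alg_mulA alg_mul1l alg_mul1r alg_mulDl alg_mulDr alg_one_neq0.

Fact alg_scaleA (a b : R) (x : alg R) : ascale a (ascale b x) = ascale (a * b) x.
Proof. by apply/funext => w; rewrite /ascale mulrA. Qed.
Fact alg_scale1 : left_id 1 (@ascale R).
Proof. by move=> x; apply/funext => w; rewrite /ascale mul1r. Qed.
Fact alg_scaleDr : right_distributive (@ascale R) +%R.
Proof. by move=> a x y; apply/funext => w; exact: mulrDr. Qed.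
Fact alg_scaleDl (x : alg R) : {morph (@ascale R)^~ x : a b / a + b}.
Proof. by move=> a b; apply/funext => w; exact: mulrDl. Qed.

HB.instance Definition _ := GRing.Zmodule_isLmodule.Build R (alg R)
  alg_scaleA alg_scale1 alg_scaleDr alg_scaleDl.

Fact alg_scaleAl (a : R) (x y : alg R) : a *: (x * y) = a *: x * y.
Proof. by apply/funext => w; rewrite /GRing.scale /= /ascale -amulZl. Qed.
Fact alg_scaleAr (a : R) (x y : alg R) : a *: (x * y) = x * (a *: y).
Proof. by apply/funext => w; rewrite /GRing.scale /= /ascale -amulZr. Qed.

HB.instance Definition _ := GRing.Lmodule_isLalgebra.Build R (alg R) alg_scaleAl.
HB.instance Definition _ := GRing.Lalgebra_isAlgebra.Build R (alg R) alg_scaleAr.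

End Instances.

(** * Coefficients, and the Clifford relations of the generators *)

Section Pointwise.
Variable R : fieldType.
Implicit Types (x y : alg R) (w : word).

Lemma algD x y w : (x + y) w = x w + y w. Proof. by []. Qed.
Lemma algN x w : (- x) w = - x w. Proof. by []. Qed.
Lemma algZ (a : R) x w : (a *: x) w = a * x w. Proof. by []. Qed.
Lemma algM x y w : (x * y) w = amul x y w. Proof. by []. Qed.
Lemma alg0 w : (0 : alg R) w = 0. Proof. by []. Qed.
Definition algE := (algD, algN, algZ, alg0).

Lemma alg_sum I (r : seq I) (P : pred I) (F : I -> alg R) w :
  (\sum_(i <- r | P i) F i) w = \sum_(i <- r | P i) F i w.
Proof.
elim: r => [|i r IH]; first by rewrite !big_nil.
by rewrite !big_cons; case: ifP => _; rewrite ?algD IH.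
Qed.

Lemma clAM c d : clA R c * clA R d = sgn R c d *: clA R (clx c d).
Proof.
apply/funext => -[e|e j w]; last first.
  rewrite algZ mulr0 algM /= -/(azero R) amul0l addr0.
  by apply: big1 => a _; rewrite mulr0.
rewrite algZ algM /= sum_cl.
case: c d e => [[] []] [[] []] [[] []]; rewrite /sgn /clx /=; ring.
Qed.

Lemma QgenQ j : Qgen R j * Qgen R j = -1.
Proof.
rewrite /Qgen; case: j; rewrite clAM /sgn /clx /= expr1 scaleN1r; exact.
Qed.

Lemma Q12 : Q1 R * Q2 R = - (Q2 R * Q1 R).
Proof. by rewrite !clAM /sgn /clx /= expr0 expr1 scale1r scaleN1r opprK. Qed.

End Pointwise.
(** * Degree filtration *)

Section Degree.
Variable R : fieldType.
Implicit Types (x y z u : alg R) (w : word).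

Definition zero_at n x := forall w, deg w = n -> x w = 0.
Definition hom n x := forall i, i <> n -> zero_at i x.
(** The filtration behind formal convergence; congruence modulo degree [n] is phrased below as
    [ord_ge n (x - y)]. *)
Definition ord_ge n x := forall i, (i < n)%N -> zero_at i x.

Lemma zero_atD n x y : zero_at n x -> zero_at n y -> zero_at n (x + y).
Proof. by move=> hx hy w hw; rewrite algD hx ?hy ?addr0. Qed.

Lemma zero_atZ n (a : R) x : zero_at n x -> zero_at n (a *: x).
Proof. by move=> hx w hw; rewrite algZ hx ?mulr0. Qed.

(** Cutting a word splits its degree as [i + j], so one vanishing factor for each such pair is
    enough. Both the grading and the filtration obtain their multiplicativity from this form. *)
Lemma amul_eq0 x y w :
  (forall i j, (i + j)%N = deg w -> zero_at i x \/ zero_at j y) ->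
  (x * y) w = 0.
Proof.
rewrite algM; elim: w x => [c|c j w IH] x H /=.
  apply: big1 => a _.
  by case: (H 0%N 0%N erefl) => h; rewrite (h (WEnd _)) // ?(mulr0, mul0r).
rewrite IH ?addr0 => [|i k hik].
  apply: big1 => a _.
  have [h|h] := H 0%N (deg w).+1 erefl.
    by rewrite (h (WEnd _)) // mulr0 mul0r.
  by rewrite (h (WCons _ _ _)) // mulr0.
have [h|h] := H i.+1 k (congr1 S hik); [left|by right].
by move=> v hv; apply: h => /=; rewrite hv.
Qed.

Lemma hom_add n x y : hom n x -> hom n y -> hom n (x + y).
Proof. by move=> hx hy i hi; apply: zero_atD; [exact: hx|exact: hy]. Qed.

Lemma hom_scale n (a : R) x : hom n x -> hom n (a *: x).
Proof. by move=> hx i hi; apply: zero_atZ; exact: hx. Qed.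

Lemma hom_opp n x : hom n x -> hom n (- x).
Proof. by rewrite -scaleN1r; exact: hom_scale. Qed.

Lemma hom_sub n x y : hom n x -> hom n y -> hom n (x - y).
Proof. by move=> hx hy; apply: hom_add => //; exact: hom_opp. Qed.

Lemma hom_mul m n x y : hom m x -> hom n y -> hom (m + n) (x * y).
Proof.
move=> hx hy i hi w hw; apply: amul_eq0 => a b hab.
case: (eqVneq a m) => [am|/eqP]; last by left; exact: hx.
right; apply: hy => bn; apply: hi; by rewrite -am -bn hab.
Qed.

Lemma hom_clA c : hom 0 (clA R c).
Proof. by case=> // i _ [|]. Qed.

Lemma hom_Qgen j : hom 0 (Qgen R j).
Proof. by case: j; exact: hom_clA. Qed.

Lemma hom_Rgen j : hom 1 (Rgen R j).
Proof.
move=> i hi [c|c k [d|d l w]] // hw.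
by case: hi.
Qed.

Lemma ord_geD n x y : ord_ge n x -> ord_ge n y -> ord_ge n (x + y).
Proof. by move=> hx hy i hi; apply: zero_atD; [exact: hx|exact: hy]. Qed.

Lemma ord_geN n x : ord_ge n x -> ord_ge n (- x).
Proof.
by move=> hx i hi; rewrite -scaleN1r; apply: zero_atZ; exact: hx.
Qed.

Lemma ord_geB n x y : ord_ge n x -> ord_ge n y -> ord_ge n (x - y).
Proof. by move=> hx hy; apply: ord_geD => //; exact: ord_geN. Qed.

Lemma ord_geW m n x : (m <= n)%N -> ord_ge n x -> ord_ge m x.
Proof. by move=> mn hx i im; apply: hx; exact: leq_trans mn. Qed.

Lemma ord_ge0 x : ord_ge 0 x.
Proof. by move=> i. Qed.

Lemma ord_geM m n x y : ord_ge m x -> ord_ge n y -> ord_ge (m + n) (x * y).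
Proof.
move=> hx hy i hi w hw; apply: amul_eq0 => a b hab.
have [am|ma] := ltnP a m; first by left; exact: hx.
right; apply: hy; rewrite -(ltn_add2l m); apply: leq_ltn_trans hi.
by rewrite -hw -hab leq_add2r.
Qed.

Lemma ord_geMl n x y : ord_ge n y -> ord_ge n (x * y).
Proof. exact: (ord_geM (@ord_ge0 x)). Qed.

Lemma ord_geMr n x y : ord_ge n x -> ord_ge n (x * y).
Proof. by move=> hx; rewrite -[n]addn0; apply: ord_geM. Qed.

Lemma hom_ord_ge n x : hom n x -> ord_ge n x.
Proof. by move=> hx i hi; apply: hx => e; rewrite e ltnn in hi. Qed.

Lemma hom_ord_ge_eq0 n x : hom n x -> ord_ge n.+1 x -> x = 0.
Proof.
move=> hx ox; apply/funext => w.
have [e|/eqP ne] := eqVneq (deg w) n; last exact: (hx _ ne w).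
by apply: (ox (deg w)) => //; rewrite e.
Qed.

Lemma ord_ge_eq0 x : (forall n, ord_ge n x) -> x = 0.
Proof. by move=> h; apply/funext => w; exact: (h (deg w).+1 (deg w)). Qed.

Lemma ord_ge_eq n x y : ord_ge n (x - y) <->
  (forall w, (deg w < n)%N -> x w = y w).
Proof.
split=> [h w hw|h i hi w hw].
  by apply/eqP; rewrite -subr_eq0; apply/eqP; exact: (h _ hw w).
by rewrite algD algN h ?subrr // hw.
Qed.

Lemma ord_geX n x : ord_ge 1 x -> ord_ge n (x ^+ n).
Proof.
move=> hx; elim: n => [|n IH]; first exact: ord_ge0.
by rewrite exprS -add1n; exact: ord_geM.
Qed.

Definition hpart n x : alg R := fun w => if deg w == n then x w else 0.

Lemma hom_hpart n x : hom n (hpart n x).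
Proof. by move=> i hi w hw; rewrite /hpart hw; case: eqP. Qed.

Lemma hpart_hom n x : hom n x -> hpart n x = x.
Proof.
by move=> hx; apply/funext => w; rewrite /hpart; case: eqP => // /hx ->.
Qed.

Lemma hpart_zero_at n x : zero_at n x -> hpart n x = 0.
Proof. by move=> hx; apply/funext => w; rewrite /hpart; case: eqP => // /hx. Qed.

Lemma hpartD n x y : hpart n (x + y) = hpart n x + hpart n y.
Proof.
by apply/funext => w; rewrite algD /hpart; case: eqP => //; rewrite addr0.
Qed.

Lemma hpartZ n a x : hpart n (a *: x) = a *: hpart n x.
Proof.
by apply/funext => w; rewrite algZ /hpart; case: eqP => //; rewrite mulr0.
Qed.

Lemma hpartN n x : hpart n (- x) = - hpart n x.
Proof. by rewrite -scaleN1r hpartZ scaleN1r. Qed.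

Lemma hpart_sum n I (r : seq I) (P : pred I) (F : I -> alg R) :
  hpart n (\sum_(i <- r | P i) F i) = \sum_(i <- r | P i) hpart n (F i).
Proof.
apply: (big_morph (hpart n) (@hpartD n)).
by apply/funext => w; rewrite /hpart if_same.
Qed.

Lemma zero_at_sub_hpart n x : zero_at n (x - hpart n x).
Proof. by move=> w hw; rewrite algD algN /hpart hw eqxx subrr. Qed.

Lemma ord_ge_sub_hpart n x : ord_ge n x -> ord_ge n.+1 (x - hpart n x).
Proof.
move=> hx i; rewrite ltnS leq_eqVlt => /orP[/eqP ->|hi].
  exact: zero_at_sub_hpart.
by apply: ord_geB hi => //; apply: hom_ord_ge; exact: hom_hpart.
Qed.

Lemma hpart_mul0l n c x : hom 0 c -> hpart n (c * x) = c * hpart n x.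
Proof.
move=> hc; rewrite -[in LHS](subrK (hpart n x) x) mulrDr hpartD.
rewrite [X in X + _]hpart_zero_at ?add0r; last first.
  move=> w hw; apply: amul_eq0 => -[|i] k; last by left; exact: hc.
  by rewrite hw => <-; right; exact: zero_at_sub_hpart.
by rewrite hpart_hom //; exact: (hom_mul hc (@hom_hpart n x)).
Qed.

Lemma hpart_mul0r n c x : hom 0 c -> hpart n (x * c) = hpart n x * c.
Proof.
move=> hc; rewrite -[in LHS](subrK (hpart n x) x) mulrDl hpartD.
rewrite [X in X + _]hpart_zero_at ?add0r; last first.
  move=> w hw; apply: amul_eq0 => i [|k]; last by right; exact: hc.
  by rewrite addn0 hw => ->; left; exact: zero_at_sub_hpart.
by rewrite hpart_hom //; rewrite -{1}[n]addn0; apply: hom_mul => //; exact: hom_hpart.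
Qed.

Definition trunc n x := \sum_(i < n) hpart i x.

Lemma truncE n x w : trunc n x w = if (deg w < n)%N then x w else 0.
Proof.
rewrite /trunc alg_sum; case: ltnP => h.
  rewrite (bigD1 (Ordinal h)) //= big1 ?addr0 => [|i /eqP ne].
    by rewrite /hpart eqxx.
  by rewrite /hpart; case: eqP => // e; case: ne; apply: val_inj.
apply: big1 => i _; rewrite /hpart; case: eqP => // e.
by have := ltn_ord i; rewrite -e ltnNge h.
Qed.

Lemma ord_ge_trunc n x : ord_ge n (x - trunc n x).
Proof. by apply/ord_ge_eq => w hw; rewrite truncE hw. Qed.

Lemma ord_geMB n x x' y y' : ord_ge n (x - x') -> ord_ge n (y - y') ->
  ord_ge n (x * y - x' * y').
Proof.
move=> hx hy; have -> : x * y - x' * y' = (x - x') * y + x' * (y - y').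
  by rewrite mulrBl mulrBr addrA subrK.
by apply: ord_geD; [exact: ord_geMr|exact: ord_geMl].
Qed.

Lemma hpartM n x y :
  hpart n (x * y) = \sum_(i < n.+1) \sum_(j < n.+1 | (i + j == n)%N)
    hpart i x * hpart j y.
Proof.
(* Truncating both factors above degree [n] leaves the degree [n] part alone and makes the sums
   finite. *)
rewrite -[x * y](subrK (trunc n.+1 x * trunc n.+1 y)) hpartD.
rewrite hpart_zero_at ?add0r; last first.
  exact: (ord_geMB (@ord_ge_trunc n.+1 x) (@ord_ge_trunc n.+1 y)) (ltnSn n).
rewrite mulr_suml hpart_sum; apply: eq_bigr => i _.
rewrite mulr_sumr hpart_sum [RHS]big_mkcond; apply: eq_bigr => j _.
have h := hom_mul (@hom_hpart i x) (@hom_hpart j y).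
case: eqP => [e|ne]; first by apply: hpart_hom; rewrite -{1}e.
by apply: hpart_zero_at; apply: h => /esym.
Qed.

(** * The geometric series as a two-sided inverse *)

Section Inverse.
Variable u : alg R.
Hypothesis u1 : ord_ge 1 u.

Lemma apowE x m : apow x m = x ^+ m.
Proof. by elim: m => // m IH; rewrite exprS -IH. Qed.

(** The power [(- u) ^+ m] has order at least [m], so the bound depending on the word may be
    replaced by any common larger one. *)
Lemma inv1pE n w : (deg w < n)%N ->
  inv1p u w = (\sum_(m < n) (- u) ^+ m) w.
Proof.
move=> hn; rewrite alg_sum /inv1p.
rewrite (big_ord_widen n (fun m => apow (aopp u) m w)) // big_mkcond /=.
apply: eq_bigr => m _; rewrite ltnS; case: leqP => [_|h]; first by rewrite apowE.
have /(_ (deg w) h w erefl) -> // := @ord_geX m (- u) (ord_geN u1).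
Qed.

Lemma ord_ge_inv1p n : ord_ge n (inv1p u - \sum_(m < n) (- u) ^+ m).
Proof. by apply/ord_ge_eq => w hw; exact: inv1pE. Qed.

Lemma geom_mull n : (1 + u) * (\sum_(m < n) (- u) ^+ m) = 1 - (- u) ^+ n.
Proof.
elim: n => [|n IH]; first by rewrite big_ord0 mulr0 expr0 subrr.
by rewrite big_ord_recr /= mulrDr IH mulrDl mul1r exprS mulNr opprK addrA subrK.
Qed.

Lemma geom_mulr n : (\sum_(m < n) (- u) ^+ m) * (1 + u) = 1 - (- u) ^+ n.
Proof.
elim: n => [|n IH]; first by rewrite big_ord0 mul0r expr0 subrr.
by rewrite big_ord_recr /= mulrDl IH mulrDr mulr1 exprSr mulrN opprK addrA subrK.
Qed.

(** Modulo each degree [n] the inverse is a finite geometric sum, for which the product telescopes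
    up to a term of order [n]. *)
Lemma mulr_inv1p : (1 + u) * inv1p u = 1.
Proof.
apply/eqP; rewrite -subr_eq0; apply/eqP/ord_ge_eq0 => n.
have -> : (1 + u) * inv1p u - 1
   = (1 + u) * (inv1p u - \sum_(m < n) (- u) ^+ m) - (- u) ^+ n.
  rewrite mulrBr -addrA; congr (_ + _).
  by rewrite geom_mull opprB addrAC subrr add0r.
apply: ord_geB; first by apply: ord_geMl; exact: ord_ge_inv1p.
by apply: ord_geX; exact: ord_geN.
Qed.

Lemma mul_inv1p : inv1p u * (1 + u) = 1.
Proof.
apply/eqP; rewrite -subr_eq0; apply/eqP/ord_ge_eq0 => n.
have -> : inv1p u * (1 + u) - 1
   = (inv1p u - \sum_(m < n) (- u) ^+ m) * (1 + u) - (- u) ^+ n.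
  rewrite mulrBl -addrA; congr (_ + _).
  by rewrite geom_mulr opprB addrAC subrr add0r.
apply: ord_geB; first by apply: ord_geMr; exact: ord_ge_inv1p.
by apply: ord_geX; exact: ord_geN.
Qed.

End Inverse.
End Degree.
(** * Conjugation by the Clifford generators *)

Section Clifford.
Variable R : fieldType.
Implicit Types (x y Q : alg R).

(* [Q^-1 = - Q], so this is both [Q^-1 x Q] and [Q x Q^-1]. *)
Definition conjQ Q x := - (Q * x * Q).

Lemma conjQD Q x y : conjQ Q (x + y) = conjQ Q x + conjQ Q y.
Proof. by rewrite /conjQ mulrDr mulrDl opprD. Qed.

Lemma conjQZ Q a x : conjQ Q (a *: x) = a *: conjQ Q x.
Proof. by rewrite /conjQ -scalerAr -scalerAl scalerN. Qed.

Lemma conjQN Q x : conjQ Q (- x) = - conjQ Q x.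
Proof. by rewrite -scaleN1r conjQZ scaleN1r. Qed.

Lemma conjQ_sum Q I (r : seq I) (P : pred I) (F : I -> alg R) :
  conjQ Q (\sum_(i <- r | P i) F i) = \sum_(i <- r | P i) conjQ Q (F i).
Proof.
apply: (big_morph (conjQ Q) (@conjQD Q)).
by rewrite /conjQ mulr0 mul0r oppr0.
Qed.

Lemma conjQM Q x y : Q * Q = -1 -> conjQ Q (x * y) = conjQ Q x * conjQ Q y.
Proof.
move=> QQ; rewrite /conjQ mulrNN -(mulrA (Q * x)) (mulrA Q (Q * y)) (mulrA Q Q).
by rewrite QQ !mulN1r mulNr mulrN !mulrA.
Qed.

Lemma conjQK Q x : Q * Q = -1 -> conjQ Q (conjQ Q x) = x.
Proof.
move=> QQ; rewrite /conjQ mulrN mulNr opprK !mulrA QQ mulN1r !mulNr.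
by rewrite -mulrA QQ mulrN mulr1 opprK.
Qed.

(** Exchanging [P] and [Q] produces one sign on each side of [x], and the two signs cancel. *)
Lemma conjQC Q P x : P * Q = - (Q * P) ->
  conjQ P (conjQ Q x) = conjQ Q (conjQ P x).
Proof.
move=> PQ; rewrite /conjQ !mulrN !mulNr !opprK !mulrA PQ.
rewrite !mulNr; have QP : Q * P = - (P * Q) by rewrite PQ opprK.
by rewrite -mulrA [X in - (_ * X)]QP mulrN opprK !mulrA.
Qed.

Lemma conjQC12 i j x : conjQ (Qgen R i) (conjQ (Qgen R j) x)
  = conjQ (Qgen R j) (conjQ (Qgen R i) x).
Proof.
by case: i; case: j => //; apply: conjQC; rewrite /Qgen Q12 ?opprK.
Qed.

(** One formula for both cases: when [Q * Q = -1], the two parts are the eigenprojections of the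
    involution [conjQ Q]. *)
Lemma partbE (b : bool) Q x :
  partb b Q x = 2^-1 *: (x + (-1) ^+ b *: conjQ Q x).
Proof.
have e : amul (amul (invQ Q) x) Q = conjQ Q x.
  by rewrite -[LHS]/((- Q) * x * Q) !mulNr.
case: b; rewrite /partb /part0 /part1 e.
  by rewrite expr1 scaleN1r.
by rewrite expr0 scale1r.
Qed.

Lemma part0E Q x : part0 Q x = 2^-1 *: (x + conjQ Q x).
Proof. by have := partbE false Q x; rewrite expr0 scale1r. Qed.

Lemma conjQ_partb (b : bool) Q x : Q * Q = -1 ->
  conjQ Q (partb b Q x) = (-1) ^+ b *: partb b Q x.
Proof.
move=> QQ; rewrite partbE conjQZ scalerA mulrC -scalerA; congr (_ *: _).
by rewrite conjQD conjQZ conjQK // scalerDr scalerA -expr2 sqrr_sign scale1r addrC.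
Qed.

(** Commuting involutions: projecting for one of them preserves the eigenvectors of the other. This
    keeps the inner splitting by [Q1] visible after the outer splitting by [Q2]. *)
Lemma conjQ_partb_other (b : bool) (e : R) i j x :
  conjQ (Qgen R i) x = e *: x ->
  conjQ (Qgen R i) (partb b (Qgen R j) x) = e *: partb b (Qgen R j) x.
Proof.
move=> h; rewrite !partbE conjQZ conjQD conjQZ conjQC12 h conjQZ.
by apply/funext => w; rewrite !algE; ring.
Qed.

Lemma conjQ_rvar j k : exists e : R, conjQ (Qgen R j) (rvar R k) = e *: rvar R k.
Proof.
case: j; last first.
  exists ((-1) ^+ odd (k %/ 2)).
  apply: (@conjQ_partb_other _ _ false true).
  by apply: conjQ_partb; exact: (QgenQ R false).
by exists ((-1) ^+ odd k); apply: conjQ_partb; exact: (QgenQ R true).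
Qed.

Lemma hom_conjQ n j x : hom n x -> hom n (conjQ (Qgen R j) x).
Proof.
move=> hx; apply: hom_opp; rewrite -[n]addn0 -[n]add0n.
by apply: hom_mul; [apply: hom_mul|]=> //; exact: hom_Qgen.
Qed.

Lemma hom_partb n b j x : hom n x -> hom n (partb b (Qgen R j) x).
Proof.
move=> hx; rewrite partbE; apply: hom_scale; apply: hom_add => //.
by apply: hom_scale; exact: hom_conjQ.
Qed.

Lemma hom_rvar k : hom 1 (rvar R k).
Proof.
apply: (@hom_partb _ _ true); apply: (@hom_partb _ _ false).
rewrite -[X in hom X]addn0; apply: hom_mul; first exact: hom_Rgen.
by apply: hom_opp; exact: hom_Qgen.
Qed.

Lemma hpart_conjQ n j x : hpart n (conjQ (Qgen R j) x) = conjQ (Qgen R j) (hpart n x).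
Proof.
by rewrite /conjQ hpartN hpart_mul0r ?hpart_mul0l //; exact: hom_Qgen.
Qed.

End Clifford.

(** * Scalar FQ operations *)

Section FQ.
Variable R : fieldType.
Implicit Types (x y : alg R) (f : series R).

Definition mono (t : seq 'I_8) : alg R := aprod (map (@rvar R) t).

Lemma mono_cat s t : mono (s ++ t) = mono s * mono t.
Proof.
elim: s => [|k s IH]; first by rewrite mul1r.
by rewrite cat_cons -[LHS]/(rvar R k * mono (s ++ t)) IH mulrA.
Qed.

Lemma hom_mono t : hom (size t) (mono t).
Proof.
elim: t => [|k t IH]; first exact: hom_clA.
exact: (hom_mul (@hom_rvar R k) IH).
Qed.

(** Conjugation is multiplicative and each split variable is an eigenvector; this is what makes the
    scalar FQ operations stable under conjugation. *)
Lemma conjQ_mono j t : exists e : R, conjQ (Qgen R j) (mono t) = e *: mono t.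
Proof.
elim: t => [|k t [e he]].
  exists 1; rewrite scale1r /conjQ -[mono [::]]/(1 : alg R) mulr1 QgenQ.
  by rewrite opprK.
have [d hd] := conjQ_rvar R j k; exists (d * e).
rewrite -[mono (k :: t)]/(rvar R k * mono t) conjQM ?QgenQ // hd he.
by rewrite -scalerAl -scalerAr scalerA.
Qed.

(** The degree [n] layer of the scalar FQ operations; only the values of [f] on sequences of length
    [n] enter. *)
Definition hspan n x :=
  exists f : series R, x = \sum_(t : n.-tuple 'I_8) f t *: mono t.

Lemma hspan0 n : hspan n 0.
Proof. by exists (fun=> 0); rewrite big1 // => t _; rewrite scale0r. Qed.

Lemma hspanD n x y : hspan n x -> hspan n y -> hspan n (x + y).
Proof.
move=> [f ->] [g ->]; exists (fun t => f t + g t).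
by rewrite -big_split; apply: eq_bigr => t _; rewrite scalerDl.
Qed.

Lemma hspanZ n (a : R) x : hspan n x -> hspan n (a *: x).
Proof.
move=> [f ->]; exists (fun t => a * f t).
by rewrite scaler_sumr; apply: eq_bigr => t _; rewrite scalerA.
Qed.

Lemma hspan_sum n I (r : seq I) (P : pred I) (F : I -> alg R) :
  (forall i, P i -> hspan n (F i)) -> hspan n (\sum_(i <- r | P i) F i).
Proof.
move=> h; apply: (big_ind (hspan n)) => //; first exact: hspan0.
exact: hspanD.
Qed.

Lemma hspan_mono t : hspan (size t) (mono t).
Proof.
exists (fun s => (s == t)%:R); rewrite (bigD1 (in_tuple t)) //= eqxx scale1r.
rewrite big1 ?addr0 // => s ne.
by rewrite -[X in _ == X]/(val (in_tuple t)) val_eqE (negbTE ne) scale0r.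
Qed.

Lemma hspanM m n x y : hspan m x -> hspan n y -> hspan (m + n) (x * y).
Proof.
move=> [f ->] [g ->]; rewrite mulr_suml; apply: hspan_sum => s _.
rewrite mulr_sumr; apply: hspan_sum => t _.
rewrite -scalerAl -scalerAr scalerA -mono_cat; apply: hspanZ.
by have := hspan_mono (s ++ t); rewrite size_cat !size_tuple.
Qed.

Lemma hspan_conjQ n j x : hspan n x -> hspan n (conjQ (Qgen R j) x).
Proof.
move=> [f ->]; rewrite conjQ_sum; apply: hspan_sum => t _.
have [e he] := conjQ_mono j t; rewrite conjQZ he scalerA; apply: hspanZ.
by have := hspan_mono t; rewrite size_tuple.
Qed.

(** Each split variable is homogeneous of degree 1, so a word of degree [n] sees only the monomials
    of length [n]. *)
Lemma evalFQE f n : hpart n (evalFQ f) = \sum_(t : n.-tuple 'I_8) f t *: mono t.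
Proof.
apply/funext => w; rewrite alg_sum /hpart; case: eqP => [<-|ne]; last first.
  rewrite big1 // => t _; rewrite algZ (hom_mono _ erefl) ?mulr0 //.
  by rewrite size_tuple.
rewrite /evalFQ big_ord_recr /= big1 ?add0r // => m _.
apply: big1 => t _; rewrite -/(mono t) (@hom_mono t (deg w)) ?mulr0 //.
by rewrite size_tuple => e; have := ltn_ord m; rewrite -e ltnn.
Qed.

Definition scalarFQ x := exists f, x = evalFQ f.

Lemma hpart_ext x y : (forall n, hpart n x = hpart n y) -> x = y.
Proof.
move=> h; apply/funext => w; have := congr1 (fun z : alg R => z w) (h (deg w)).
by rewrite /hpart eqxx.
Qed.

(** Different degrees involve disjoint sets of coefficients, so series chosen degree by degree glue
    into a single one. This reduces closure properties to [hspan]. *)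
Lemma scalarFQP x : scalarFQ x <-> forall n, hspan n (hpart n x).
Proof.
split=> [[f ->] n|h]; first by exists f; rewrite evalFQE.
have [F hF] := choice h; exists (fun t => F (size t) t).
apply: hpart_ext => n; rewrite evalFQE hF.
by apply: eq_bigr => t _; rewrite size_tuple.
Qed.

Lemma scalarFQD x y : scalarFQ x -> scalarFQ y -> scalarFQ (x + y).
Proof.
move=> /scalarFQP hx /scalarFQP hy; apply/scalarFQP => n.
by rewrite hpartD; exact: hspanD.
Qed.

Lemma scalarFQZ (a : R) x : scalarFQ x -> scalarFQ (a *: x).
Proof. by move=> /scalarFQP hx; apply/scalarFQP => n; rewrite hpartZ; exact: hspanZ. Qed.

Lemma scalarFQN x : scalarFQ x -> scalarFQ (- x).
Proof. by rewrite -scaleN1r; exact: scalarFQZ. Qed.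

Lemma scalarFQM x y : scalarFQ x -> scalarFQ y -> scalarFQ (x * y).
Proof.
move=> /scalarFQP hx /scalarFQP hy; apply/scalarFQP => n; rewrite hpartM.
apply: hspan_sum => i _; apply: hspan_sum => j /eqP e.
by have := hspanM (hx i) (hy j); rewrite e.
Qed.

Lemma scalarFQ_conjQ j x : scalarFQ x -> scalarFQ (conjQ (Qgen R j) x).
Proof.
move=> /scalarFQP hx; apply/scalarFQP => n; rewrite hpart_conjQ.
exact: hspan_conjQ.
Qed.

Lemma hspan_scalarFQ_hom n x : hspan n x -> scalarFQ_hom n x.
Proof.
(* Cutting [f] to length [n] makes it homogeneous without changing the sum. *)
move=> [f xE]; exists (fun t => if size t == n then f t else 0); split.
  by move=> t /eqP /negbTE ->.
apply: hpart_ext => m; rewrite evalFQE.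
have hx : hom n x.
  rewrite xE => i hi w hw; rewrite alg_sum big1 // => t _.
  by rewrite algZ (@hom_mono t i) ?mulr0 // size_tuple.
have [->|ne] := eqVneq m n.
  rewrite hpart_hom // {1}xE; apply: eq_bigr => t _.
  by rewrite size_tuple eqxx.
rewrite hpart_zero_at; last by apply: hx; exact/eqP.
by rewrite big1 // => t _; rewrite size_tuple (negbTE ne) scale0r.
Qed.

Lemma scalarFQ_hom_hom n x : scalarFQ_hom n x -> hom n x.
Proof.
move=> [f [hf ->]] i hi w hw.
have := congr1 (fun z : alg R => z w) (evalFQE f i); rewrite {1}/hpart hw eqxx => ->.
by rewrite big1 ?alg0 // => t _; rewrite hf ?scale0r // size_tuple.
Qed.

Lemma scalarFQ_hom_scalarFQ n x : scalarFQ_hom n x -> scalarFQ x.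
Proof. by move=> [f [_ ->]]; exists f. Qed.

(** Closure under formal limits: the degree [n] part of [x] is that of any approximant agreeing
    beyond degree [n]. *)
Lemma scalarFQ_approx x : (forall n, exists2 y, scalarFQ y & ord_ge n (x - y)) ->
  scalarFQ x.
Proof.
move=> h; apply/scalarFQP => n; have [y /scalarFQP hy hxy] := h n.+1.
rewrite -[x](subrK y) hpartD hpart_zero_at ?add0r //.
exact: hxy.
Qed.

Lemma scalarFQ1 : scalarFQ 1.
Proof.
apply: (@scalarFQ_hom_scalarFQ 0); apply: hspan_scalarFQ_hom.
exact: (@hspan_mono [::]).
Qed.

Lemma scalarFQ_inv1p u : ord_ge 1 u -> scalarFQ u -> scalarFQ (inv1p u).
Proof.
move=> u1 hu; apply: scalarFQ_approx => n.
exists (\sum_(m < n) (- u) ^+ m); last exact: ord_ge_inv1p.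
apply: (big_ind scalarFQ) => [||m _].
- by rewrite -(scale0r 1); apply: scalarFQZ; exact: scalarFQ1.
- exact: scalarFQD.
elim: (nat_of_ord m) => [|k IH]; first exact: scalarFQ1.
by rewrite exprS; apply: scalarFQM => //; exact: scalarFQN.
Qed.

Lemma evalFQ_const f : ord_ge 1 (evalFQ f - f [::] *: 1).
Proof.
apply/ord_ge_eq => w; rewrite ltnS leqn0 => /eqP w0.
have := congr1 (fun z : alg R => z w) (evalFQE f 0); rewrite {1}/hpart w0 /= => ->.
by rewrite (big_pred1 [tuple]) //= => t; apply/esym/eqP; exact: tuple0.
Qed.

End FQ.
(** * Successive conjugations *)

Section Conjugation.
Variable R : realFieldType.
Implicit Types (u v x y Q D : alg R) (X Y : bool -> alg R) (U V : nat -> alg R).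

(** Leibniz rule at leading order: in [(a - a') * b + a' * (b - b')], replacing [b] and [a'] by
    their constant terms costs only order [n.+1]. *)
Lemma defect_mul n Qa Qb a a' b b' Da Db :
  ord_ge 1 (a' - Qa) -> ord_ge 1 (b - Qb) ->
  ord_ge n Da -> ord_ge n (b - b') ->
  ord_ge n.+1 (a - a' - Da) -> ord_ge n.+1 (b - b' - Db) ->
  ord_ge n.+1 (a * b - a' * b' - (Da * Qb + Qa * Db) : alg R).
Proof.
move=> ha hb hDa hbb hDa' hDb.
have -> : a * b - a' * b' - (Da * Qb + Qa * Db)
  = (a - a' - Da) * b + Da * (b - Qb)
    + ((a' - Qa) * (b - b') + Qa * (b - b' - Db)).
  rewrite !(mulrBl, mulrBr); apply/funext => w; rewrite !algE; lra.
apply: ord_geD; apply: ord_geD.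
- exact: ord_geMr.
- by rewrite -addn1; exact: ord_geM.
- by rewrite -add1n; exact: ord_geM.
- exact: ord_geMl.
Qed.

Definition conj1p u X : bool -> alg R := fun j => (1 + u) * X j * inv1p u.

(** The inverse is never expanded. With [Y] the conjugate, [Y * (1 + u) = (1 + u) * X j] first shows
    that [Y - X j] has order [n]; used again, it leaves an error all of whose terms have order at
    least [n.+1]. *)
Lemma conj1p_first_order n u X j : (0 < n)%N -> ord_ge n u ->
  ord_ge 1 (X j - Qgen R j) ->
  ord_ge n.+1 (conj1p u X j - (X j + (u * Qgen R j - Qgen R j * u))).
Proof.
move=> n0 hu hX; set Q := Qgen R j; set Y := conj1p u X j.
have YE : Y + Y * u = X j + u * X j.
  have : Y * (1 + u) = (1 + u) * X j.
    by rewrite /Y /conj1p -mulrA mul_inv1p ?mulr1 //; exact: ord_geW hu.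
  by rewrite mulrDr mulrDl mulr1 mul1r.
have YX : ord_ge n (Y - X j).
  have -> : Y - X j = u * X j - Y * u.
    apply/funext => w; have := congr1 (fun z : alg R => z w) YE.
    rewrite !algE; lra.
  by apply: ord_geB; [exact: ord_geMr|exact: ord_geMl].
have -> : Y - (X j + (u * Q - Q * u))
    = u * (X j - Q) - (Y - X j) * u - (X j - Q) * u.
  rewrite !(mulrBl, mulrBr); apply/funext => w.
  have := congr1 (fun z : alg R => z w) YE; rewrite !algE; lra.
apply: ord_geB; first apply: ord_geB.
- by rewrite -addn1; exact: ord_geM.
(* This term has order [n + n], which reaches [n.+1] because [n] is positive. *)
- by apply: (@ord_geW _ _ (n + n)); [rewrite -addn1 leq_add2l|exact: ord_geM].
- by rewrite -add1n; exact: ord_geM.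
Qed.

Definition cliff X := (forall j, X j * X j = -1) /\
  X false * X true + X true * X false = 0.

(** Since [- Q_j] inverts [Q_j], this expresses that [X j] has the vectorial form [f * Q_j]. *)
Definition scalar_over_Q X := forall j, scalarFQ (X j * - Qgen R j).

Lemma cliff_conj1p u X : ord_ge 1 u -> cliff X -> cliff (conj1p u X).
Proof.
move=> u1 [XX Xac].
have M j k : conj1p u X j * conj1p u X k = (1 + u) * (X j * X k) * inv1p u.
  by rewrite /conj1p !mulrA -(mulrA _ (inv1p u)) mul_inv1p // mulr1.
split=> [j|]; first by rewrite M XX mulrN1 mulNr mulr_inv1p.
by rewrite !M -mulrDl -mulrDr Xac mulr0 mul0r.
Qed.

(** Moving [Q_j] leftwards past [inv1p u] replaces that factor by its conjugate, which is again a
    scalar FQ operation. *)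
Lemma scalar_over_Q_conj1p u X : ord_ge 1 u -> scalarFQ u ->
  scalar_over_Q X -> scalar_over_Q (conj1p u X).
Proof.
move=> u1 hu hX j.
have -> : conj1p u X j * - Qgen R j
    = (1 + u) * (X j * - Qgen R j) * conjQ (Qgen R j) (inv1p u).
  rewrite /conj1p /conjQ !(mulrN, mulNr) opprK !mulrA.
  by rewrite -(mulrA _ (Qgen R j) (Qgen R j)) QgenQ mulrN1 !mulNr.
apply: scalarFQM; last by apply: scalarFQ_conjQ; exact: scalarFQ_inv1p.
by apply: scalarFQM => //; apply: scalarFQD => //; exact: scalarFQ1.
Qed.

Lemma cliff_Qgen : cliff (Qgen R).
Proof. by split=> [j|]; rewrite ?QgenQ //= Q12 addNr. Qed.

Lemma scalar_over_Q_Qgen : scalar_over_Q (Qgen R).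
Proof. by move=> j; rewrite mulrN QgenQ opprK; exact: scalarFQ1. Qed.

Lemma commutator_conjQ u j :
  u * Qgen R j - Qgen R j * u = (u - conjQ (Qgen R j) u) * Qgen R j.
Proof.
rewrite mulrBl /conjQ mulNr -(mulrA _ (Qgen R j) (Qgen R j)) QgenQ.
by rewrite mulrN1 opprK.
Qed.

(** * One correction step: matching the given operation in degree [n] *)

Section Correction.
Variables (n : nat) (Psi X : bool -> alg R).

(** The element [g_j] of the outline above, with [false] standing for index 1 and [true] for index
    2. *)
Definition defect j := hpart n (Psi j - X j) * - Qgen R j.

Definition correction :=
  2^-1 *: (defect false + part0 (Q1 R) (defect true)).

Hypotheses (n0 : (0 < n)%N) (cPsi : cliff Psi) (cX : cliff X)
  (sPsi : scalar_over_Q Psi) (sX : scalar_over_Q X)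
  (PsiQ : forall j, ord_ge 1 (Psi j - Qgen R j))
  (PsiX : forall j, ord_ge n (Psi j - X j)).

Let D j := hpart n (Psi j - X j).

Lemma ord_ge_XQ j : ord_ge 1 (X j - Qgen R j).
Proof.
have -> : X j - Qgen R j = (Psi j - Qgen R j) - (Psi j - X j).
  by apply/funext => w; rewrite !algE; lra.
by apply: ord_geB => //; apply: ord_geW (PsiX j).
Qed.

Lemma hspan_defect j : hspan n (defect j).
Proof.
rewrite /defect -hpart_mul0r; last by apply: hom_opp; exact: hom_Qgen.
(* Letting the degree vary turns the goal into the scalar FQ property of the whole difference. *)
rewrite mulrBl; move: n; apply/scalarFQP; apply: scalarFQD; first exact: sPsi.
by apply: scalarFQN; exact: sX.
Qed.

Lemma hspan_correction : hspan n correction.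
Proof.
apply: hspanZ; apply: hspanD; first exact: hspan_defect.
rewrite part0E; apply: hspanZ; apply: hspanD; first exact: hspan_defect.
by apply: (@hspan_conjQ _ _ false); exact: hspan_defect.
Qed.

(** Linearization of a product of two components at the Clifford system; applied to each Clifford
    relation below. *)
Lemma leading_defect j k :
  ord_ge n.+1 (Psi j * Psi k - X j * X k - (D j * Qgen R k + Qgen R j * D k)).
Proof.
apply: defect_mul; [exact: ord_ge_XQ|exact: PsiQ| |exact: PsiX| |].
- by apply: hom_ord_ge; exact: hom_hpart.
- exact: ord_ge_sub_hpart.
- exact: ord_ge_sub_hpart.
Qed.

Lemma hom_DQ j k : hom n (D j * Qgen R k + Qgen R j * D k).
Proof.
apply: hom_add.
  by rewrite -[X in hom X]addn0; apply: hom_mul; [exact: hom_hpart|exact: hom_Qgen].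
by rewrite -[X in hom X]add0n; apply: hom_mul; [exact: hom_Qgen|exact: hom_hpart].
Qed.

(** Both squares equal [-1], so the linear term has order [n.+1]; being homogeneous of degree [n],
    it vanishes. *)
Lemma DQ_anticomm j : D j * Qgen R j + Qgen R j * D j = 0.
Proof.
apply: (hom_ord_ge_eq0 (@hom_DQ j j)).
rewrite -[X in ord_ge _ X]opprK; apply: ord_geN.
have := @leading_defect j j.
by rewrite (proj1 cPsi) (proj1 cX) subrr sub0r.
Qed.

Lemma DQ_mixed : D false * Q2 R + Q1 R * D true
  + (D true * Q1 R + Q2 R * D false) = 0.
Proof.
apply: (hom_ord_ge_eq0 (hom_add (@hom_DQ false true) (@hom_DQ true false))).
rewrite -[X in ord_ge _ X]opprK; apply: ord_geN.
have := ord_geD (@leading_defect false true) (@leading_defect true false).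
congr (ord_ge _ _); apply/funext => w.
have := congr1 (fun z : alg R => z w) (proj2 cPsi).
have := congr1 (fun z : alg R => z w) (proj2 cX).
rewrite !algE; lra.
Qed.

Lemma defectK j : defect j * Qgen R j = D j.
Proof. by rewrite /defect -mulrA mulNr QgenQ opprK mulr1. Qed.

Lemma conjQ_defect j : conjQ (Qgen R j) (defect j) = - defect j.
Proof.
rewrite /conjQ -mulrA defectK /defect mulrN opprK; apply/eqP.
by rewrite eqr_oppLR -addr_eq0 addrC DQ_anticomm.
Qed.

Lemma defect_compat :
  defect false - conjQ (Q2 R) (defect false)
  = defect true - conjQ (Q1 R) (defect true).
Proof.
(* Right multiplication by [Q2 * Q1] strips the generators and leaves each [g_j] or its conjugate up
   to sign. *)
have := congr1 (fun z => z * (Q2 R * Q1 R)) DQ_mixed.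
rewrite -(defectK false) -(defectK true) mul0r /= /conjQ.
set g1 := defect false; set g2 := defect true.
have q1 := QgenQ R false; have q2 := QgenQ R true; rewrite /= in q1 q2.
rewrite !mulrDl.
have -> : g1 * Q1 R * Q2 R * (Q2 R * Q1 R) = g1.
  by rewrite mulrA -(mulrA _ (Q2 R) (Q2 R)) q2 mulrN1 mulNr -mulrA q1 mulrN1 opprK.
have -> : Q1 R * (g2 * Q2 R) * (Q2 R * Q1 R) = - (Q1 R * g2 * Q1 R).
  by rewrite !mulrA -(mulrA _ (Q2 R) (Q2 R)) q2 mulrN1 mulNr.
have q12 : Q1 R * (Q2 R * Q1 R) = Q2 R.
  by rewrite mulrA Q12 mulNr -mulrA q1 mulrN1 opprK.
have -> : g2 * Q2 R * Q1 R * (Q2 R * Q1 R) = - g2.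
  by rewrite -(mulrA _ (Q1 R)) q12 -mulrA q2 mulrN1.
have -> : Q2 R * (g1 * Q1 R) * (Q2 R * Q1 R) = Q2 R * g1 * Q2 R.
  by rewrite (mulrA (Q2 R) g1) -(mulrA _ (Q1 R)) q12.
move=> e; apply/funext => w; have := congr1 (fun z : alg R => z w) e.
rewrite !algE; lra.
Qed.

(** For [Q1], the first summand changes sign and the second is fixed. For [Q2], [defect_compat]
    trades the contribution of [g_1] for that of [g_2], and the terms [conjQ (Q1 R) g_2] cancel. *)
Lemma correction_conjQ j : correction - conjQ (Qgen R j) correction = defect j.
Proof.
have e1 := conjQ_defect false; have e2 := conjQ_defect true; rewrite /= in e1 e2.
rewrite /correction part0E conjQZ conjQD conjQZ conjQD.
case: j => /=; apply/funext => w.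
  have e3 := conjQC12 true false (defect true); rewrite /= in e3.
  rewrite e3 e2 conjQN.
  have := congr1 (fun z : alg R => z w) defect_compat; rewrite !algE; lra.
rewrite e1 conjQK; last exact: (QgenQ R false).
rewrite !algE; lra.
Qed.

Lemma correction_commutator j :
  correction * Qgen R j - Qgen R j * correction = D j.
Proof. by rewrite commutator_conjQ correction_conjQ defectK. Qed.

(** The inner projection kills [g_1], which anticommutes with [Q1]; what remains of [g_2] still
    anticommutes with [Q2], so the outer projection kills it. *)
Lemma correction_normalized : part0 (Q2 R) (part0 (Q1 R) correction) = 0.
Proof.
have e1 := conjQ_defect false; have e2 := conjQ_defect true; rewrite /= in e1 e2.
have -> : part0 (Q1 R) correction = 2^-1 *: part0 (Q1 R) (defect true).
  rewrite /correction !part0E !(conjQD, conjQZ) e1 conjQK; last exact: (QgenQ R false).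
  apply/funext => w; rewrite !algE; lra.
have e3 := conjQC12 true false (defect true); rewrite /= in e3.
rewrite !part0E !(conjQD, conjQZ) e3 e2 conjQN.
apply/funext => w; rewrite !algE; lra.
Qed.

Lemma ord_ge_correction : ord_ge n correction.
Proof.
apply: hom_ord_ge; apply: scalarFQ_hom_hom; apply: hspan_scalarFQ_hom.
exact: hspan_correction.
Qed.

(** The commutator of the correction with [Q_j] is exactly the degree [n] discrepancy, so agreement
    improves by one degree. *)
Lemma correction_approx j : ord_ge n.+1 (Psi j - conj1p correction X j).
Proof.
have := @conj1p_first_order n _ X j n0 ord_ge_correction (@ord_ge_XQ j).
rewrite correction_commutator => h.
have -> : Psi j - conj1p correction X j
    = (Psi j - X j - D j) - (conj1p correction X j - (X j + D j)).
  apply/funext => w; rewrite !algE; lra.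
by apply: ord_geB => //; exact: ord_ge_sub_hpart.
Qed.

End Correction.

Definition conjP U N : bool -> alg R := fun j => Pn U N * Qgen R j * Pinvn U N.

Lemma conjP0 U : conjP U 0 = Qgen R.
Proof. by apply/funext => j; rewrite /conjP mulr1 mul1r. Qed.

Lemma conjPS U N : conjP U N.+1 = conj1p (U N.+1) (conjP U N).
Proof.
apply/funext => j; rewrite /conjP -[Pn U N.+1]/((1 + U N.+1) * Pn U N).
by rewrite -[Pinvn U N.+1]/(Pinvn U N * inv1p (U N.+1)) /conj1p !mulrA.
Qed.

(** * Formal convergence of the successive conjugations *)

Section Admissible.
Variable U : nat -> alg R.
Hypothesis admU : admissible U.

Lemma hom_admissible N : hom N.+1 (U N.+1).
Proof. by apply: scalarFQ_hom_hom; exact: admU. Qed.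

Lemma ord_ge_admissible N : ord_ge N.+1 (U N.+1).
Proof. by apply: hom_ord_ge; exact: hom_admissible. Qed.

Lemma ord_ge1_admissible N : ord_ge 1 (U N.+1).
Proof. exact: ord_geW (@ord_ge_admissible N). Qed.

(** Kept conditional because the induction proving its hypothesis, in [conjP_Q], uses this step. *)
Lemma conjP_stepQ N j : ord_ge 1 (conjP U N j - Qgen R j) ->
  ord_ge N.+2 (conjP U N.+1 j
     - (conjP U N j + (U N.+1 * Qgen R j - Qgen R j * U N.+1))).
Proof.
by move=> h; rewrite conjPS; apply: conj1p_first_order => //; exact: ord_ge_admissible.
Qed.

Lemma ord_ge_commutator N j :
  ord_ge N.+1 (U N.+1 * Qgen R j - Qgen R j * U N.+1).
Proof.
by apply: ord_geB; [apply: ord_geMr|apply: ord_geMl]; exact: ord_ge_admissible.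
Qed.

Lemma conjP_Q N j : ord_ge 1 (conjP U N j - Qgen R j).
Proof.
elim: N => [|N IH]; first by rewrite conjP0 subrr.
have h := conjP_stepQ IH; set c := U N.+1 * _ - _ in h.
have -> : conjP U N.+1 j - Qgen R j
  = conjP U N.+1 j - (conjP U N j + c) + (conjP U N j - Qgen R j) + c.
  apply/funext => w; rewrite !algE; lra.
apply: ord_geD; first by apply: ord_geD => //; exact: ord_geW h.
exact: ord_geW (@ord_ge_commutator N j).
Qed.

Lemma conjP_first_order N j :
  ord_ge N.+2 (conjP U N.+1 j
     - (conjP U N j + (U N.+1 * Qgen R j - Qgen R j * U N.+1))).
Proof. by apply: conjP_stepQ; exact: conjP_Q. Qed.

(** The factor of index [M.+1] affects only degrees above [M], so all degrees up to [N] are final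
    after [N] factors. *)
Lemma conjP_stable N M j : (N <= M)%N ->
  ord_ge N.+1 (conjP U M j - conjP U N j).
Proof.
elim: M => [|M IH]; first by rewrite leqn0 => /eqP ->; rewrite subrr.
rewrite leq_eqVlt => /orP[/eqP ->|NM]; first by rewrite subrr.
have h := @conjP_first_order M j; have hc := @ord_ge_commutator M j.
set c := U M.+1 * _ - _ in h hc.
have -> : conjP U M.+1 j - conjP U N j
  = conjP U M.+1 j - (conjP U M j + c) + (conjP U M j - conjP U N j) + c.
  apply/funext => w; rewrite !algE; lra.
rewrite ltnS in NM.
apply: ord_geD; last exact: ord_geW hc.
by apply: ord_geD; [apply: ord_geW h; exact: leqW|exact: IH].
Qed.

(** Stability gives convergence an explicit rate, the form used in every later comparison. *)
Lemma flim_conjPP j x : flim (fun N => conjP U N j) x <->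
  forall N, ord_ge N.+1 (x - conjP U N j).
Proof.
split=> [h N|h w].
  (* A stage past both [N0] and [N] already has the limit value at [w] and still agrees with stage
     [N] there. *)
  apply/ord_ge_eq => w hw; have [N0 /(_ (maxn N0 N))] := h w.
  rewrite leq_maxl => <- //; apply: (proj1 (ord_ge_eq N.+1 _ _)) hw.
  by apply: conjP_stable; exact: leq_maxr.
exists (deg w) => N hN; apply/esym; apply: (proj1 (ord_ge_eq N.+1 _ _)) => //.
Qed.

Lemma cliff_conjP N : cliff (conjP U N).
Proof.
elim: N => [|N IH]; first by rewrite conjP0; exact: cliff_Qgen.
by rewrite conjPS; apply: cliff_conj1p => //; exact: ord_ge1_admissible.
Qed.

Lemma scalar_over_Q_conjP N : scalar_over_Q (conjP U N).
Proof.
elim: N => [|N IH]; first by rewrite conjP0; exact: scalar_over_Q_Qgen.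
rewrite conjPS; apply: scalar_over_Q_conj1p => //; first exact: ord_ge1_admissible.
exact: scalarFQ_hom_scalarFQ (admU (ltn0Sn N)).
Qed.

End Admissible.

Definition pairb x y : bool -> alg R := fun j => if j then y else x.

Lemma conj_reprP U x y : admissible U ->
  conj_repr U x y <-> forall j N, ord_ge N.+1 (pairb x y j - conjP U N j).
Proof.
move=> admU; split=> [[h1 h2] [] N|h].
- exact: (proj1 (flim_conjPP admU true y)).
- exact: (proj1 (flim_conjPP admU false x)).
split.
- exact: (proj2 (flim_conjPP admU false x) (h false)).
- exact: (proj2 (flim_conjPP admU true y) (h true)).
Qed.

Lemma cliffordP x y : clifford_productive x y <-> cliff (pairb x y).
Proof.
split=> [[h1 [h2 h3]]|[h h3]]; first by split=> // -[].
by split; [exact: (h false)|split; [exact: (h true)|]].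
Qed.

(** * Uniqueness under the normalization *)

Lemma commute_part0 j u : u * Qgen R j = Qgen R j * u -> part0 (Qgen R j) u = u.
Proof.
move=> h; rewrite part0E /conjQ -h -mulrA QgenQ mulrN1 opprK.
apply/funext => w; rewrite !algE; lra.
Qed.

Lemma part0B Q x y : part0 Q (x - y) = part0 Q x - part0 Q y.
Proof.
rewrite !part0E conjQD conjQN; apply/funext => w; rewrite !algE; lra.
Qed.

Lemma conj_repr_unique U V x y :
  admissible U -> normalized U -> conj_repr U x y ->
  admissible V -> normalized V -> conj_repr V x y ->
  forall i, (1 <= i)%N -> U i = V i.
Proof.
move=> aU nU /(conj_reprP _ _ aU) rU aV nV /(conj_reprP _ _ aV) rV.
suff H N : forall i, (1 <= i <= N)%N -> U i = V i.
  by move=> i i1; apply: (H i); rewrite i1 leqnn.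
elim: N => [|N IH] i; first by case: i.
(* The [N]-th conjugate depends only on the factors 1 to [N], which agree by induction. *)
have E : conjP U N = conjP V N.
  have [e1 e2] : Pn U N = Pn V N /\ Pinvn U N = Pinvn V N.
    elim: N IH {i} => // N IH' IH.
    have [|e1 e2] := IH'.
      by move=> i /andP[i1 iN]; apply: IH; rewrite i1 leqW.
    by split; rewrite /= ?e1 ?e2 IH ?leqnn.
  by rewrite /conjP e1 e2.
case/andP=> i1; rewrite leq_eqVlt ltnS => /orP[/eqP ->|iN]; last first.
  by apply: IH; rewrite i1.
set d := U N.+1 - V N.+1.
have hd : hom N.+1 d by apply: hom_sub; exact: hom_admissible.
(* Both conjugates of stage [N.+1] match the same limit below degree [N.+2], so the two commutators
   agree there; homogeneity makes this exact. *)
have dQ j : d * Qgen R j = Qgen R j * d.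
  apply/eqP; rewrite -subr_eq0; apply/eqP; apply: (@hom_ord_ge_eq0 _ N.+1).
    apply: hom_sub; [rewrite -[N.+1]addn0|rewrite -[N.+1]add0n];
      by apply: hom_mul => //; exact: hom_Qgen.
  have a := @conjP_first_order U aU N j; have b := @conjP_first_order V aV N j.
  have c := ord_geB (rU j N.+1) (rV j N.+1).
  have := ord_geB (ord_geB b a) c; rewrite E.
  congr (ord_ge _ _); rewrite /d !(mulrBl, mulrBr).
  apply/funext => w; rewrite !algE; lra.
apply/eqP; rewrite -subr_eq0 -/d; apply/eqP.
(* Commuting with both generators, [d] equals its own double projection, which the normalizations
   make zero. *)
rewrite -(commute_part0 (dQ true)) -[in LHS](commute_part0 (dQ false)).
rewrite /= /d !part0B.
have -> : part0 (Q2 R) (part0 (Q1 R) (U N.+1)) = 0 by exact: nU.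
have -> : part0 (Q2 R) (part0 (Q1 R) (V N.+1)) = 0 by exact: nV.
by rewrite subrr.
Qed.

(** * Recursive construction of the normalized factors *)

Section Existence.
Variable Psi : bool -> alg R.
Hypotheses (cPsi : cliff Psi) (sPsi : scalar_over_Q Psi)
  (PsiQ : forall j, ord_ge 1 (Psi j - Qgen R j)).

(** Each factor depends on the conjugate reached so far, so the recursion runs on the conjugates and
    [factor] is read off from them. *)
Fixpoint approx N : bool -> alg R :=
  if N is N'.+1 then conj1p (correction N Psi (approx N')) (approx N')
  else Qgen R.

Definition factor N := correction N Psi (approx N.-1).

Lemma conjP_factor N : conjP factor N = approx N.
Proof. by elim: N => [|N IH]; rewrite ?conjP0 // conjPS IH. Qed.

(** The invariants are carried together: the next correction is a scalar FQ operation by the second,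
    and cancels the leading discrepancy by the first and third. At stage 0 the third is [PsiQ]. *)
Lemma approxP N : [/\ cliff (approx N), scalar_over_Q (approx N) &
  forall j, ord_ge N.+1 (Psi j - approx N j)].
Proof.
elim: N => [|N [cN sN oN]].
  by split=> //; [exact: cliff_Qgen|exact: scalar_over_Q_Qgen].
have o := ord_ge_correction sPsi sN (n := N.+1).
have o1 := ord_geW (ltn0Sn N) o.
split=> /=; first exact: cliff_conj1p.
- apply: scalar_over_Q_conj1p => //; apply: (@scalarFQ_hom_scalarFQ _ N.+1).
  by apply: hspan_scalarFQ_hom; exact: hspan_correction.
- by move=> j; apply: correction_approx.
Qed.

Lemma admissible_factor : admissible factor.
Proof.
case=> // N _; have [cN sN oN] := approxP N.
by apply: hspan_scalarFQ_hom; exact: hspan_correction.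
Qed.

Lemma normalized_factor : normalized factor.
Proof.
case=> // N _; have [cN sN oN] := approxP N.
exact: correction_normalized.
Qed.

End Existence.

(** * Passage between series and conjugation representations *)

Lemma Psi_over_Q (f : series R) j :
  evalFQ f * Qgen R j * - Qgen R j = evalFQ f.
Proof. by rewrite -mulrA mulrN QgenQ opprK mulr1. Qed.

Lemma conj_repr_exists (f1 f2 : series R) :
  clifford_conservative f1 f2 -> clifford_productive (Psi1 f1) (Psi2 f2) ->
  exists U, [/\ admissible U, normalized U & conj_repr U (Psi1 f1) (Psi2 f2)].
Proof.
move=> [f10 f20] /cliffordP; set Psi := pairb _ _ => cPsi.
have PsiE j : Psi j = evalFQ (if j then f2 else f1) * Qgen R j by case: j.
have sPsi : scalar_over_Q Psi.
  by move=> j; rewrite PsiE Psi_over_Q; eexists.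
have PsiQ j : ord_ge 1 (Psi j - Qgen R j).
  rewrite PsiE -{2}[Qgen R j]mul1r -mulrBl; apply: ord_geMr.
  have := evalFQ_const (if j then f2 else f1).
  by case: (j); rewrite ?f10 ?f20 scale1r.
exists (factor Psi); split; first exact: admissible_factor.
- exact: normalized_factor.
apply/conj_reprP; first exact: admissible_factor.
by move=> j N; rewrite conjP_factor; have [_ _] := approxP cPsi sPsi PsiQ N; exact.
Qed.

Lemma conj_repr_series U : admissible U -> exists f1 f2 : series R,
  [/\ clifford_conservative f1 f2, clifford_productive (Psi1 f1) (Psi2 f2) &
      conj_repr U (Psi1 f1) (Psi2 f2)].
Proof.
(* The limit is read at [w] from stage [deg w], by which that coefficient is final. *)
move=> aU; pose P j : alg R := fun w => conjP U (deg w) j w.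
have PX j N : ord_ge N.+1 (P j - conjP U N j).
  apply/ord_ge_eq => w hw; apply/esym.
  by have /ord_ge_eq := conjP_stable aU j (hw : (deg w <= N)%N); exact.
have PQ j : ord_ge 1 (P j - Qgen R j) by have := PX j 0%N; rewrite conjP0.
have sP : scalar_over_Q P.
  move=> j; apply: scalarFQ_approx => n.
  exists (conjP U n j * - Qgen R j); first exact: scalar_over_Q_conjP.
  by rewrite -mulrBl; apply: ord_geMr; exact: ord_geW (PX j n).
(* Products respect the filtration, so the Clifford relations of every stage pass to the limit. *)
have PM j k N : ord_ge N (P j * P k - conjP U N j * conjP U N k).
  by apply: ord_geMB; [exact: ord_geW (PX j N)|exact: ord_geW (PX k N)].
have cP : cliff P.
  split=> [j|].
    apply/eqP; rewrite -subr_eq0; apply/eqP; apply: ord_ge_eq0 => N.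
    by have := PM j j N; rewrite (proj1 (cliff_conjP aU N)).
  apply: ord_ge_eq0 => N; have := ord_geD (PM false true N) (PM true false N).
  congr (ord_ge _ _); apply/funext => w.
  have := congr1 (fun z : alg R => z w) (proj2 (cliff_conjP aU N)).
  rewrite !algE; lra.
have [f fE] := choice sP.
have PE j : evalFQ (f j) * Qgen R j = P j.
  by rewrite -fE -mulrA mulNr QgenQ opprK mulr1.
(* The coefficient at the empty Clifford word isolates the constant term, and [P j] agrees with
   [Q_j] in degree 0. *)
have f0 j : f j [::] = 1.
  have /ord_ge_eq/(_ (WEnd (false, false)) isT) e1 := evalFQ_const (f j).
  have : ord_ge 1 (evalFQ (f j) - 1).
    have -> : evalFQ (f j) - 1 = (P j - Qgen R j) * - Qgen R j.
      by rewrite mulrBl [X in _ = _ - X]mulrN QgenQ opprK fE.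
    exact: ord_geMr.
  move=> /ord_ge_eq/(_ (WEnd (false, false)) isT); rewrite e1 algZ.
  by rewrite -[(1 : alg R) _]/(1 : R) mulr1.
exists (f false), (f true).
have -> : Psi1 (f false) = P false by exact: (PE false).
have -> : Psi2 (f true) = P true by exact: (PE true).
have PP : pairb (P false) (P true) = P by apply/funext => -[].
split; first by split; exact: f0.
- by apply/cliffordP; rewrite PP.
- by apply/(conj_reprP _ _ aU); rewrite PP.
Qed.

End Conjugation.

Theorem mainTheorem12 :
  (forall (R : realFieldType) (f1 f2 : series R),
     clifford_conservative f1 f2 ->
     clifford_productive (Psi1 f1) (Psi2 f2) ->
     (exists U : nat -> alg R,
        admissible U /\ conj_repr U (Psi1 f1) (Psi2 f2)) /\
     (exists U : nat -> alg R,
        admissible U /\ normalized U /\ conj_repr U (Psi1 f1) (Psi2 f2)) /\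
     (forall U V : nat -> alg R,
        admissible U -> normalized U -> conj_repr U (Psi1 f1) (Psi2 f2) ->
        admissible V -> normalized V -> conj_repr V (Psi1 f1) (Psi2 f2) ->
        forall i, (1 <= i)%N -> U i = V i)) /\
  (forall (R : realFieldType) (U : nat -> alg R),
     admissible U ->
     exists f1 f2 : series R,
       clifford_conservative f1 f2 /\
       clifford_productive (Psi1 f1) (Psi2 f2) /\
       conj_repr U (Psi1 f1) (Psi2 f2)).
Proof.
split=> [R f1 f2 cons prod|R U aU]; last first.
  by have [f1 [f2 [? ? ?]]] := conj_repr_series aU; exists f1, f2.
have [U [aU nU rU]] := conj_repr_exists cons prod.
split; first by exists U.
split; first by exists U.
by move=> V W aV nV rV aW nW rW; exact: (conj_repr_unique aV nV rV aW nW rW).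
Qed.
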